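(* Let $k, t \in \mathbb{N}$ and let $$ m = t+ \left\lfloor k^k \left( 1- \frac{k!}{k^k} \right)^t \right\rfloor.$$ Then $\chi_{DP}(K_{k,m}) = k+1$.
   Context: $\mathbb{N}=\{1,2,3,\ldots\}$. All graphs are finite and simple; $K_{k,m}$ is the complete bipartite graph with parts of sizes $k$ and $m$. A cover of a graph $G$ is a pair $\mathcal{H}=(L,H)$ where $H$ is a graph and $L: V(G) \to \mathcal{P}(V(H))$ satisfies: (1) the sets $\{L(u): u \in V(G)\}$ partition $V(H)$; (2) for every $u \in V(G)$, $H[L(u)]$ is complete; (3) if $E_H(L(u),L(v))$ (the set of edges of $H$ with one endpoint in $L(u)$ and the other in $L(v)$) is nonempty, then $u=v$ or $uv \in E(G)$; (4) if $uv \in E(G)$ then $E_H(L(u),L(v))$ is a matching (possibly empty). The cover is $k$-fold if $|L(u)|=k$ for all $u$. An $\mathcal{H}$-coloring of $G$ is an independent set of $H$ of size $|V(G)|$. The DP-chromatic number $\chi_{DP}(G)$ is the smallest $k \in \mathbb{N}$ such that $G$ has an $\mathcal{H}$-coloring for every $k$-fold cover $\mathcal{H}$ of $G$. *)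

(* Defs.v *)
From mathcomp Require Import all_boot all_order all_algebra.

Set Implicit Arguments.
Unset Strict Implicit.
Unset Printing Implicit Defensive.

Record sgraph := SGraph {
  vertex :> finType;
  adj : rel vertex;
  adj_sym : symmetric adj;
  adj_irrefl : irreflexive adj }.

Section Graphs.
Variable G : sgraph.
Implicit Types A B I : {set G}.

Definition clique A := forall x y, x \in A -> y \in A -> x != y -> adj x y.

Definition independent I := forall x y, x \in I -> y \in I -> ~~ adj x y.

(* An edge is represented by the set of its two endpoints. *)
Definition edges_between A B : {set {set G}} :=
  [set [set x; y] | x in A, y in B & adj x y].

Definition matching (E : {set {set G}}) : bool := trivIset E.

End Graphs.

Section Covers.
Variables G H : sgraph.

(* The partition condition is on the indexed family L: distinct vertices of G *)
(* have disjoint lists.                                                       *)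
Record is_cover (L : G -> {set H}) : Prop := IsCover {
  cover_disjoint : forall u v, u != v -> [disjoint L u & L v];
  cover_full : \bigcup_u L u = [set: H];
  cover_clique : forall u, clique (L u);
  cover_adj : forall u v, edges_between (L u) (L v) != set0 ->
    u = v \/ adj u v;
  cover_matching : forall u v, adj u v ->
    matching (edges_between (L u) (L v)) }.

Definition fold_cover (k : nat) (L : G -> {set H}) : Prop :=
  is_cover L /\ forall u, #|L u| = k.

(* Whether I is a coloring depends on the cover only through H. *)
Definition is_cover_coloring (I : {set H}) : Prop :=
  independent I /\ #|I| = #|G|.

End Covers.

Definition DP_colorable (G : sgraph) (k : nat) : Prop :=
  forall (H : sgraph) (L : G -> {set H}), fold_cover k L ->
    exists I : {set H}, is_cover_coloring G I.

Definition is_DP_chromatic_number (G : sgraph) (n : nat) : Prop :=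
  [/\ 0 < n, DP_colorable G n &
      forall j, 0 < j -> DP_colorable G j -> n <= j].

Section CompleteBipartite.
Variables k m : nat.

Definition Kbip_adj : rel ('I_k + 'I_m)%type := fun x y =>
  match x, y with
  | inl _, inr _ | inr _, inl _ => true
  | _, _ => false
  end.

Lemma Kbip_adj_sym : symmetric Kbip_adj.
Proof. by case=> [x|x] [y|y]. Qed.

Lemma Kbip_adj_irrefl : irreflexive Kbip_adj.
Proof. by case. Qed.

Definition Kbip : sgraph := SGraph Kbip_adj_sym Kbip_adj_irrefl.

End CompleteBipartite.

(* Main.v *)
(* The vertices of the side of size k can be colored arbitrarily, and each of
   them forbids at most one color at a vertex of the other side, so lists of
   size k+1 suffice. For the lower bound, let every vertex b of the side of size
   m block a set of colorings of the side of size k, namely those leaving no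
   color for b. On average over the covers considered, b blocks a fraction
   k!/k^k of any given set of colorings, so t vertices can be chosen greedily to
   leave at most k^k (1 - k!/k^k)^t colorings unblocked; each of these is then
   blocked by a vertex of its own. *)
Require Import Defs.
From mathcomp Require Import all_boot all_order all_algebra.

Set Implicit Arguments.
Unset Strict Implicit.
Unset Printing Implicit Defensive.

Import Order.TTheory GRing.Theory Num.Theory.
Local Open Scope ring_scope.

(** * Matchings between disjoint lists as uniqueness of neighbours *)

Section MatchingNeighbours.
Variables (H : sgraph) (A B : {set H}).

Lemma edges_between_mem (x y : H) :
  x \in A -> y \in B -> adj x y -> [set x; y] \in edges_between A B.
Proof. by move=> xA yB xy; apply: imset2_f; rewrite // inE yB. Qed.

Lemma matching_neighbour_uniq (x y z : H) :
    matching (edges_between A B) -> x \in A -> y \in B -> z \in B ->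
  adj x y -> adj x z -> y = z.
Proof.
move=> /trivIsetP trivE xA yB zB xy xz.
(* Equal edges give [y = z], a loop at [x] being excluded; distinct edges would have to be disjoint,
   yet share [x]. *)
have [] := eqVneq [set x; y] [set x; z].
  move/setP/(_ y); rewrite !inE eqxx orbT => /esym /orP[/eqP yx|/eqP //].
  by move: xy; rewrite yx adj_irrefl.
move/(trivE _ _ (edges_between_mem xA yB xy)
              (edges_between_mem xA zB xz)).
by rewrite -setI_eq0 => /eqP/setP/(_ x); rewrite !inE eqxx.
Qed.

(** As [A] and [B] are disjoint, two edges that meet share an endpoint on the same side, and
    uniqueness makes their other endpoints agree. *)
Lemma matching_of_neighbour_uniq :
    [disjoint A & B] ->
    (forall x y z, x \in A -> y \in B -> z \in B ->
       adj x y -> adj x z -> y = z) ->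
    (forall x y z, x \in B -> y \in A -> z \in A ->
       adj x y -> adj x z -> y = z) ->
  matching (edges_between A B).
Proof.
move=> disjAB uniqB uniqA.
have notAB x : x \in A -> x \in B -> False.
  by move=> xA xB; rewrite (disjointFr disjAB xA) in xB.
apply/trivIsetP => e e' /imset2P[x y xA]; rewrite inE => /andP[yB xy] {e}->.
case/imset2P=> x' y' x'A; rewrite inE => /andP[y'B xy'] {e'}->; apply: contraR.
rewrite -setI_eq0 => /set0Pn[z]; rewrite !inE.
case/andP=> /orP[]/eqP-> /orP[]/eqP e.
- by subst x'; rewrite (uniqB x y' y).
- by subst y'; case: (notAB x).
- by subst x'; case: (notAB y).
- by subst y'; rewrite (uniqA y x' x) // adj_sym.
Qed.

End MatchingNeighbours.

(** * Upper bound: greedy coloring from lists of size [k.+1] *)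

Section UpperBound.
Variables k m : nat.

Lemma DP_colorable_Kbip : DP_colorable (Kbip k m) k.+1.
Proof.
move=> H L [[disjL _ _ adjL matchL] cardL].
have memL (u : Kbip k m) : exists x, x \in L u.
  by apply/set0Pn; rewrite -card_gt0 cardL.
pose g a := xchoose (memL (inl a)).
have gL a : g a \in L (inl a) by apply: xchooseP (memL (inl a)).
have freeL b : exists y, (y \in L (inr b)) && [forall a, ~~ adj (g a) y].
  apply/existsP; apply: contraT; rewrite negb_exists => /forallP noy.
  have blocked y : y \in L (inr b) -> exists a, adj (g a) y.
    move=> yL; move: (noy y); rewrite yL negb_forall /= => /existsP[a].
    by rewrite negbK; exists a.
  (* By the matching condition, [N a] is the only color that [g a] can forbid at [b]. If all [k.+1]
     colors were forbidden, they would all lie in the image of [N], which has at most [k]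
     elements. *)
  pose N a := [pick y in L (inr b) | adj (g a) y].
  have: (#|[set Some y | y in L (inr b)]| <= #|[set N a | a : 'I_k]|)%N.
    apply/subset_leq_card/subsetP => _ /imsetP[y yL ->].
    have [a ay] := blocked y yL; apply/imsetP; exists a => //.
    rewrite /N; case: pickP => [z /andP[zL az]|/(_ y)]; last by rewrite yL ay.
    have matchab := matchL (inl a) (inr b) isT.
    by congr Some; apply: (matching_neighbour_uniq matchab) ay az.
  rewrite card_imset; last by move=> ? ? [].
  move=> /leq_trans/(_ (leq_imset_card _ _)).
  by rewrite cardL card_ord ltnn.
pose h u := match u with inl a => g a | inr b => xchoose (freeL b) end.
have hL u : h u \in L u.
  by case: u => [a|b] /=; [apply: gL | case/andP: (xchooseP (freeL b))].
have hfree a b : ~~ adj (g a) (h (inr b)).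
  by case/andP: (xchooseP (freeL b)) => _ /forallP.
have h_inj : injective h.
  move=> u v huv; apply/eqP; apply: contraT => /disjL/disjointFr/(_ (hL u)).
  by rewrite huv hL.
exists [set h u | u : Kbip k m]; split; last by rewrite card_imset.
move=> _ _ /imsetP[u _ ->] /imsetP[v _ ->].
have [->|uv] := eqVneq u v; first by rewrite adj_irrefl.
apply/negP => huv.
have: edges_between (L u) (L v) != set0.
  by apply/set0Pn; exists [set h u; h v]; apply: edges_between_mem.
case/adjL => [/eqP|]; first by rewrite (negPf uv).
case: u v {uv} huv => [a|b] [a'|b'] //= huv _; last rewrite adj_sym in huv.
  by have := hfree a b'; rewrite huv.
by have := hfree a' b; rewrite huv.
Qed.

End UpperBound.

(** Lists are cliques, so an independent set has at most one element in each; with as many elements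
    as there are lists, it misses none. *)
Lemma cover_coloring_meets_lists (G H : sgraph) (L : G -> {set H})
    (I : {set H}) (u : G) :
  is_cover L -> is_cover_coloring G I -> exists2 x, x \in I & x \in L u.
Proof.
move=> [_ fullL cliqueL _ _] [indI cardI].
have owner x : exists v, x \in L v.
  have: x \in \bigcup_v L v by rewrite fullL.
  by case/bigcupP => v _; exists v.
pose p x := xchoose (owner x).
have pP x : x \in L (p x) by apply: xchooseP (owner x).
have p_inj : {in I &, injective p}.
  move=> x y xI yI pxy; apply/eqP; apply: contraT => xy.
  by have := indI x y xI yI; rewrite (cliqueL (p x)) // pxy.
have: u \in p @: I.
  suff -> : p @: I = [set: G] by [].
  by apply/eqP; rewrite eqEcard subsetT cardsT card_in_imset // cardI leqnn.
by case/imsetP => x xI ->; exists x.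
Qed.

(* The bad cover is built for every list size [j <= k], not only [j = k], which
   spares a proof that DP-colorability is monotone in the list size. Colors are
   added modulo [k], and each [s b] shifts the lists of the side of size [k]. *)
Section ShiftCover.
Variables (n j m : nat) (le_jk : (j <= n.+1)%N).
Local Notation k := n.+1.
Variable s : 'I_m -> {ffun 'I_k -> 'I_k}.

Lemma widen_ord_inj : injective (widen_ord le_jk).
Proof. by move=> i i' e; apply: val_inj; apply: (congr1 val e). Qed.

Definition shift_vertex := (Kbip k m * 'I_j)%type.

(** The sum is taken in ['I_k], so for [j < k] it may leave the list, and the matching may be
    partial. *)
Definition shift_edge (a : 'I_k) (i : 'I_j) (b : 'I_m) (c : 'I_j) :=
  widen_ord le_jk i + s b a == widen_ord le_jk c.

Definition shift_adj : rel shift_vertex := fun x y =>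
  match x, y with
  | (inl a, i), (inr b, c) => shift_edge a i b c
  | (inr b, c), (inl a, i) => shift_edge a i b c
  | (u, i), (v, i') => (u == v) && (i != i')
  end.

Lemma shift_adj_sym : symmetric shift_adj.
Proof.
by move=> [[a|b] i] [[a'|b'] i'] //=; rewrite eq_sym [i == _]eq_sym.
Qed.

Lemma shift_adj_irrefl : irreflexive shift_adj.
Proof. by move=> [[a|b] i] /=; rewrite !eqxx. Qed.

Definition shift_graph : sgraph := SGraph shift_adj_sym shift_adj_irrefl.

Definition shift_list (u : Kbip k m) : {set shift_graph} :=
  [set x : shift_vertex | x.1 == u].

Lemma shift_neighbour_uniq (u v : Kbip k m) (x y z : shift_graph) :
    adj u v -> x \in shift_list u -> y \in shift_list v ->
  z \in shift_list v -> adj x y -> adj x z -> y = z.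
Proof.
case: x y z => [x1 x2] [y1 y2] [z1 z2] uv /[!inE]/= /eqP-> /eqP-> /eqP->.
case: u v uv => [a|b] [a'|b'] //= _; rewrite /shift_edge => /eqP e /eqP e'.
  by congr (_, _); apply: widen_ord_inj; rewrite -e -e'.
congr (_, _); apply: widen_ord_inj.
by apply: (addIr (s b a')); rewrite e e'.
Qed.

Lemma shift_list_cover : is_cover shift_list.
Proof.
have disjL u v : u != v -> [disjoint shift_list u & shift_list v].
  move=> uv; rewrite -setI_eq0; apply/eqP/setP => x; rewrite !inE.
  by apply/andP => -[/eqP -> xv]; rewrite xv in uv.
split=> //.
- by apply/setP => x; rewrite inE; apply/bigcupP; exists x.1; rewrite ?inE.
- move=> u [x1 x2] [y1 y2]; rewrite !inE /= => /eqP -> /eqP ->.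
  rewrite xpair_eqE eqxx => xy.
  by case: u => c; rewrite /adj /= ?eqxx.
- move=> u v /set0Pn[e /imset2P[[x1 x2] [y1 y2]]].
  rewrite !inE /= => /eqP-> /andP[/eqP-> xy] {e}_.
  by case: u v xy => [a|b] [a'|b'] /=;
    by [right | case/andP=> /eqP ->; left].
- move=> u v uv; apply: matching_of_neighbour_uniq.
  + by apply: disjL; apply: contraTneq uv => ->; rewrite adj_irrefl.
  + by move=> x y z; apply: shift_neighbour_uniq.
  + by move=> x y z; apply: shift_neighbour_uniq; rewrite adj_sym.
Qed.

Lemma shift_list_fold_cover : fold_cover j shift_list.
Proof.
split=> [|u]; first exact: shift_list_cover.
have -> : shift_list u = [set (u, i) | i : 'I_j].
  apply/setP => -[v i]; rewrite inE /=; apply/eqP/imsetP => [->|[i' _ []//]].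
  by exists i.
by rewrite card_imset ?card_ord // => ? ? [].
Qed.

Lemma shift_cover_not_colorable :
    (forall f : {ffun 'I_k -> 'I_k}, exists b, injectiveb (f + s b)) ->
  ~ DP_colorable (Kbip k m) j.
Proof.
move=> blocked /(_ _ _ shift_list_fold_cover)[I colI].
have meets u : exists i : 'I_j, (u, i) \in I.
  have [[v i]] := cover_coloring_meets_lists u shift_list_cover colI.
  by rewrite inE /= => vI /eqP <-; exists i.
pose f := [ffun a => widen_ord le_jk (xchoose (meets (inl a)))].
have [b /injectiveP inj] := blocked f.
have [c cI] := meets (inr b).
(* An injective self-map of ['I_k] is onto, so some [a] has its chosen color joined to the color [c]
   chosen at [b]. *)
have [g _ fgK] := injF_bij inj.
have [indI _] := colI.
pose a := g (widen_ord le_jk c).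
have := indI _ _ (xchooseP (meets (inl a))) cI.
rewrite /= /shift_edge; have := fgK (widen_ord le_jk c).
by rewrite !ffunE => ->; rewrite eqxx.
Qed.

End ShiftCover.

(** * Greedy choice of shifts blocking every coloring of the side of size [k] *)

Section Greedy.
Variable n : nat.
Local Notation k := n.+1.
Local Notation T := {ffun 'I_k -> 'I_k}.

(* A choice [f] of colors on the side of size [k] leaves none for a vertex with
   shift [s] exactly when [f + s] is injective, hence takes all [k] values. *)
Definition unblocked (ss : seq T) : {set T} :=
  [set f : T | ~~ has (fun s => injectiveb (f + s)) ss].

(* For each [f], translation by [f] is a bijection from the shifts [s] that
   block [f] onto the [k!] injective functions. *)
Lemma sum_blocked (U : {set T}) :
  (\sum_(s : T) #|[set f in U | injectiveb (f + s)%R]| = #|U| * k`!)%N.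
Proof.
under eq_bigr => s _ do rewrite -sum1dep_card big_mkcondr.
rewrite exchange_big /= -sum_nat_const; apply: eq_bigr => f _.
rewrite -big_mkcond sum1dep_card -(card_imset _ (addrI f)).
transitivity #|[set g : T | injectiveb g]|.
  apply: eq_card => g; rewrite inE; apply/imsetP/idP => [[s]|inj].
    by rewrite inE => ? ->.
  by exists (g - f); rewrite ?inE addrC subrK.
by rewrite card_inj_ffuns !card_ord ffactnn.
Qed.

Lemma exists_good_shift (U : {set T}) :
  exists s : T,
    (#|U| * k`! <= #|[set f in U | injectiveb (f + s)%R]| * k ^ k)%N.
Proof.
apply/existsP; apply: contraT; rewrite negb_exists => /forallP small.
(* If each of the [k ^ k] shifts fell short, the total would contradict [sum_blocked]; splitting off
   the shift [0] keeps the inequality strict. *)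
have: (\sum_(s : T) #|[set f in U | injectiveb (f + s)%R]| * k ^ k
        < \sum_(s : T) #|U| * k`!)%N.
  rewrite (bigD1 (0 : T)) //= [X in (_ < X)%N](bigD1 (0 : T)) //=.
  rewrite -addSn; apply: leq_add; first by rewrite ltnNge.
  by apply: leq_sum => s _; rewrite ltnW // ltnNge.
rewrite -big_distrl /= sum_blocked sum_nat_const card_ffun !card_ord.
by rewrite mulnC ltnn.
Qed.

Lemma greedy_shifts (t : nat) :
  exists2 ss : seq T, size ss = t &
    #|unblocked ss|%:R <= k%:R ^+ k * (1 - k`!%:R / k%:R ^+ k) ^+ t :> rat.
Proof.
elim: t => [|t [ss size_ss IH]].
  exists [::] => //; rewrite expr0 mulr1 -natrX ler_nat.
  by rewrite (leq_trans (max_card _)) // card_ffun card_ord.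
have [s good] := exists_good_shift (unblocked ss).
exists (s :: ss); first by rewrite /= size_ss.
set U := unblocked ss in IH good *.
set W := [set f in U | _] in good.
have kk_gt0 : 0 < k%:R ^+ k :> rat by rewrite exprn_gt0 // ltr0n.
have cardU : (#|U| = #|W| + #|unblocked (s :: ss)|)%N.
  rewrite -(cardsID W U); congr (_ + _)%N; apply: eq_card => f.
    by rewrite !inE; case: (has _ _).
  by rewrite !inE /= negb_or; case: (has _ _); rewrite ?andbF ?andbT.
(* The factor must be nonnegative for the induction hypothesis to be multiplied by it. *)
have le_fact : k`!%:R / k%:R ^+ k <= 1 :> rat.
  rewrite ler_pdivrMr // mul1r -natrX ler_nat.
  have := max_card [set g : T | injectiveb g].
  by rewrite card_inj_ffuns card_ffun !card_ord ffactnn.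
have step : #|unblocked (s :: ss)|%:R
    <= #|U|%:R * (1 - k`!%:R / k%:R ^+ k) :> rat.
  rewrite mulrBr mulr1 {1}cardU natrD addrAC lerDr subr_ge0.
  by rewrite mulrA ler_pdivrMr // -natrX -!natrM ler_nat.
apply: le_trans step _; rewrite [_ ^+ t.+1]exprSr mulrA.
by rewrite ler_wpM2r // subr_ge0.
Qed.

Lemma blocking_shifts (t m : nat) :
    m%:Z = t%:Z
      + Num.floor (k%:R ^+ k * (1 - k`!%:R / k%:R ^+ k) ^+ t : rat) ->
  exists s : 'I_m -> T, forall f : T, exists b, injectiveb (f + s b).
Proof.
move=> hm; have [ss size_ss le_ss] := greedy_shifts t.
(* Each leftover [f] gets the shift that carries it to the identity, which is injective. *)
pose ss' := ss ++ [seq [ffun a => a] - f | f <- enum (unblocked ss)].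
have size_ss' : (size ss' <= m)%N.
  rewrite size_cat size_map -cardE size_ss -lez_nat hm PoszD lerD2l.
  by rewrite floor_ge_int.
have blocked f : exists2 s, s \in ss' & injectiveb (f + s).
  have [/hasP[s s_ss inj]|fU] := boolP (has (fun s => injectiveb (f + s)) ss).
    by exists s; rewrite // mem_cat s_ss.
  exists ([ffun a => a] - f).
    rewrite mem_cat; apply/orP; right; apply/mapP; exists f => //.
    by rewrite mem_enum inE.
  by apply/injectiveP => a b; rewrite addrC subrK !ffunE.
(* If [ss'] is shorter than [m], the remaining vertices get the shift [0]; extra shifts do no
   harm. *)
exists (fun b => nth 0 ss' b) => f; have [s s_ss' inj] := blocked f.
have lt_m : (index s ss' < m)%N.
  by apply: leq_trans size_ss'; rewrite index_mem.
by exists (Ordinal lt_m); rewrite /= nth_index.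
Qed.

End Greedy.

Theorem theorem5 (k t m : nat) (hk : (0 < k)%N) (ht : (0 < t)%N)
  (hm : m%:Z = t%:Z
    + Num.floor (k%:R ^+ k * (1 - k`!%:R / k%:R ^+ k) ^+ t : rat)) :
  is_DP_chromatic_number (Kbip k m) k.+1.
Proof.
split=> // [|j j_gt0 colj]; first exact: DP_colorable_Kbip.
(* Writing [k] as a successor gives ['I_k] its addition modulo [k]. *)
case: k hk hm colj => // n _ hm colj.
rewrite ltnNge; apply/negP => le_jk.
have [s blocked] := blocking_shifts hm.
exact: (shift_cover_not_colorable le_jk blocked colj).
Qed.
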